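(* Let $\alpha<\beta$ be real numbers and let $(u_j^0)_{j\in\mathbf{Z}}$ be a real sequence that strictly increases from the constant value $\alpha$ to the constant value $\beta$, i.e. there exist $j_0\in\mathbf{Z}$ and an integer $M\ge 1$ such that $u_j^0=\alpha$ for all $j\le j_0$, $u_j^0=\beta$ for all $j\ge j_0+M$, and $u_{j+1}^0>u_j^0$ for all $j_0\le j\le j_0+M-1$. Let $(u_j^n)_{j\in\mathbf{Z}}$, $n\in\mathbf{N}$, be the sequences obtained from $(u_j^0)_{j\in\mathbf{Z}}$ by the Després–Lagoutière scheme with Courant–Friedrichs–Levy number $\lambda=\frac{V\Delta t}{\Delta x}=\frac12$. Then for all $n\in\mathbf{N}$ large enough there exists an integer $j_\infty^n\in\mathbf{Z}$ such that $$u_j^n=\begin{cases}\alpha & \text{if } j<j_\infty^n,\\ \beta & \text{if } j>j_\infty^n.\end{cases}$$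
   Context: Després–Lagoutière scheme. Let $V,\Delta t,\Delta x>0$ with $\lambda=V\Delta t/\Delta x\in(0,1)$. Put $x_j=j\Delta x$ and $x_{j\pm1/2}=x_j\pm\frac{\Delta x}{2}$. Given $(u_j^n)_{j\in\mathbf{Z}}$, the sequence $(u_j^{n+1})_{j\in\mathbf{Z}}$ is defined as follows. (1) Reconstruction. On each cell $[x_{j-1/2},x_{j+1/2})$, if $u_{j-1}^n\ne u_{j+1}^n$ and there is $d_j^n\in[0,\Delta x]$ with $\Delta x\,u_j^n=d_j^n u_{j-1}^n+(\Delta x-d_j^n)u_{j+1}^n$, set $u_{rec}^n(x)=u_{j-1}^n$ for $x_{j-1/2}\le x<x_{j-1/2}+d_j^n$ and $u_{rec}^n(x)=u_{j+1}^n$ for $x_{j-1/2}+d_j^n\le x<x_{j+1/2}$. Otherwise set $u_{rec}^n(x)=u_j^n$ on the whole cell. (2) Translation and averaging. Set $u_j^{n+1}=\frac{1}{\Delta x}\int_{x_{j-1/2}}^{x_{j+1/2}}u_{rec}^n(x-V\Delta t)\,dx$. *)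

(* Defs.v *)
(* Stdlib reals with Coquelicot's Riemann integral. *)
From Stdlib Require Import Reals ZArith Lra Lia ClassicalEpsilon.
From Coquelicot Require Import Coquelicot.
Open Scope R_scope.

Definition node (dx : R) (j : Z) : R := IZR j * dx.
Definition left_edge (dx : R) (j : Z) : R := node dx j - dx / 2.
Definition right_edge (dx : R) (j : Z) : R := node dx j + dx / 2.

(* For [0 < dx], the only [j] with [left_edge dx j <= x < right_edge dx j];
   see [cell_index_spec]. *)
Definition cell_index (dx x : R) : Z := Int_part (x / dx + 1 / 2).

Definition jump_offset (dx : R) (u : Z -> R) (j : Z) (d : R) : Prop :=
  u (j - 1)%Z <> u (j + 1)%Z /\
  0 <= d <= dx /\
  dx * u j = d * u (j - 1)%Z + (dx - d) * u (j + 1)%Z.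

(* [epsilon] selects the offset, which is unique by [jump_offset_unique]. *)
Definition reconstruction (dx : R) (u : Z -> R) (x : R) : R :=
  let j := cell_index dx x in
  if excluded_middle_informative (exists d, jump_offset dx u j d) then
    let d := epsilon (inhabits 0) (jump_offset dx u j) in
    if Rlt_dec x (left_edge dx j + d) then u (j - 1)%Z else u (j + 1)%Z
  else u j.

Definition DL_step (V dt dx : R) (u : Z -> R) (j : Z) : R :=
  1 / dx * RInt (fun x => reconstruction dx u (x - V * dt))
                (left_edge dx j) (right_edge dx j).

Fixpoint DL_scheme (V dt dx : R) (u0 : Z -> R) (n : nat) : Z -> R :=
  match n with
  | O => u0
  | S m => DL_step V dt dx (DL_scheme V dt dx u0 m)
  end.

Lemma cell_index_spec (dx x : R) (j : Z) : 0 < dx ->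
  cell_index dx x = j <-> left_edge dx j <= x < right_edge dx j.
Proof.
intros Hdx; unfold cell_index, left_edge, right_edge, node.
set (y := x / dx); assert (Hx : x = y * dx) by (unfold y; field; lra).
split.
- intros <-; destruct (base_Int_part (y + 1 / 2)) as [H1 H2].
  set (k := IZR (Int_part (y + 1 / 2))) in *; nra.
- intros [H1 H2]; apply eq_sym, Int_part_spec; nra.
Qed.

Lemma jump_offset_unique (dx : R) (u : Z -> R) (j : Z) (d d' : R) :
  jump_offset dx u j d -> jump_offset dx u j d' -> d = d'.
Proof.
intros (Hne & _ & E) (_ & _ & E').
assert (H : (d - d') * (u (j - 1)%Z - u (j + 1)%Z) = 0) by lra.
apply Rmult_integral in H; destruct H; [lra | exfalso; apply Hne; lra].
Qed.

Lemma reconstruction_jump (dx : R) (u : Z -> R) (j : Z) (d x : R) :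
  0 < dx -> jump_offset dx u j d ->
  left_edge dx j <= x < right_edge dx j ->
  reconstruction dx u x =
    if Rlt_dec x (left_edge dx j + d) then u (j - 1)%Z else u (j + 1)%Z.
Proof.
intros Hdx Hd Hx; apply cell_index_spec in Hx; trivial.
unfold reconstruction; rewrite Hx.
destruct (excluded_middle_informative _) as [He | He];
  [| exfalso; apply He; now exists d].
pose proof (epsilon_spec (inhabits 0) (jump_offset dx u j) He) as Hs.
now rewrite (jump_offset_unique _ _ _ _ _ Hs Hd).
Qed.

Lemma reconstruction_const (dx : R) (u : Z -> R) (j : Z) (x : R) :
  0 < dx -> ~ (exists d, jump_offset dx u j d) ->
  left_edge dx j <= x < right_edge dx j ->
  reconstruction dx u x = u j.
Proof.
intros Hdx Hd Hx; apply cell_index_spec in Hx; trivial.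
unfold reconstruction; rewrite Hx.
now destruct (excluded_middle_informative _).
Qed.

Lemma ex_RInt_reconstruction_cell (dx : R) (u : Z -> R) (j : Z) : 0 < dx ->
  ex_RInt (reconstruction dx u) (left_edge dx j) (right_edge dx j).
Proof.
intros Hdx.
assert (Hlr : right_edge dx j = left_edge dx j + dx)
  by (unfold left_edge, right_edge; field).
destruct (excluded_middle_informative (exists d, jump_offset dx u j d))
  as [[d Hd] | Hn].
- assert (Hd' := proj1 (proj2 Hd)).
  apply ex_RInt_Chasles with (left_edge dx j + d).
  + apply ex_RInt_ext with (fun _ => u (j - 1)%Z); [| apply ex_RInt_const].
    rewrite Rmin_left, Rmax_right by lra; intros x Hx.
    rewrite (reconstruction_jump dx u j d) by (trivial; lra).
    destruct (Rlt_dec _ _); lra.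
  + apply ex_RInt_ext with (fun _ => u (j + 1)%Z); [| apply ex_RInt_const].
    rewrite Rmin_left, Rmax_right by lra; intros x Hx.
    rewrite (reconstruction_jump dx u j d) by (trivial; lra).
    destruct (Rlt_dec _ _); lra.
- apply ex_RInt_ext with (fun _ => u j); [| apply ex_RInt_const].
  rewrite Rmin_left, Rmax_right by lra; intros x Hx.
  rewrite (reconstruction_const dx u j) by (trivial; lra); trivial.
Qed.

(* [RInt] is total; this shows that in [DL_step] it is a genuine integral. *)
Lemma ex_RInt_DL_step (V dt dx : R) (u : Z -> R) (j : Z) :
  0 < dx -> 0 < V * dt < dx ->
  ex_RInt (fun x => reconstruction dx u (x - V * dt))
          (left_edge dx j) (right_edge dx j).
Proof.
intros Hdx Hc.
assert (E1 : right_edge dx (j - 1) = left_edge dx j)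
  by (unfold left_edge, right_edge, node; rewrite minus_IZR; field).
assert (E2 : left_edge dx (j - 1) = left_edge dx j - dx)
  by (unfold left_edge, node; rewrite minus_IZR; field).
assert (E3 : right_edge dx j = left_edge dx j + dx)
  by (unfold left_edge, right_edge; field).
assert (H1 := ex_RInt_reconstruction_cell dx u (j - 1) Hdx).
assert (H2 := ex_RInt_reconstruction_cell dx u j Hdx).
rewrite E1 in H1.
assert (H : ex_RInt (reconstruction dx u) (left_edge dx j - V * dt)
                    (right_edge dx j - V * dt)).
{ apply ex_RInt_Chasles with (left_edge dx j).
  - apply (ex_RInt_Chasles_2 (V := R_CompleteNormedModule) _ (left_edge dx (j - 1))); trivial; lra.
  - apply (ex_RInt_Chasles_1 (V := R_CompleteNormedModule) _ _ _ (right_edge dx j)); trivial; lra. }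
apply ex_RInt_ext with
  (fun y => scal 1 (reconstruction dx u (1 * y + - (V * dt)))).
- intros x _; unfold scal; simpl; unfold mult; simpl.
  rewrite Rmult_1_l; f_equal; ring.
- apply (ex_RInt_comp_lin (reconstruction dx u)).
  replace (1 * left_edge dx j + - (V * dt)) with (left_edge dx j - V * dt)
    by ring.
  replace (1 * right_edge dx j + - (V * dt)) with (right_edge dx j - V * dt)
    by ring.
  exact H.
Qed.

(* Main.v *)
(* For nondecreasing [u] and [lambda = 1/2] the increments [D j = u (j+1) - u j]
   evolve by
     D' j = min (D (j-1)) (D j) + (D (j-1) - D (j-2))^+ / 2
                                + (D j - D (j+1))^+ / 2,
   so a lower bound [c] on the increments strictly inside the support [a, b] of
   [D] persists.  In the frame moving at half a cell per step, the left end of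
   the support moves outwards by half a cell if [D a > D (a+1)] and inwards by
   half a cell otherwise.  An outward move is always followed by an inward one,
   and such a pair of moves lowers [D a] by at least [3c/4].  Since
   [0 <= D <= beta - alpha], two consecutive inward moves must keep occurring;
   the same holds at the right end, so the support shrinks until it has at most
   two points, after which it never grows again. *)
Require Import Defs.
From Stdlib Require Import Reals ZArith.
From Stdlib Require Import Lra Lia ClassicalEpsilon FunctionalExtensionality.
From Coquelicot Require Import Coquelicot.
Open Scope R_scope.

(** * The step at half a cell and its action on increments *)

Definition incr (u : Z -> R) (j : Z) : R := u (j + 1)%Z - u j.

(** Closed form of [DL_step] for nondecreasing [u]: the two summands are the averages of the
    reconstruction over the right half of cell [j - 1] and the left half of cell [j]. *)
Definition half_step (u : Z -> R) (j : Z) : R :=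
  (Rmin (u j) (2 * u (j - 1)%Z - u (j - 2)%Z) +
   Rmax (u (j - 1)%Z) (2 * u j - u (j + 1)%Z)) / 2.

Definition sharpen (p q r s : R) : R :=
  Rmin q r + Rmax 0 (q - p) / 2 + Rmax 0 (r - s) / 2.

Ltac minmax :=
  unfold sharpen, Rmin, Rmax in *;
  repeat match goal with |- context [Rle_dec ?x ?y] => destruct (Rle_dec x y) end;
  try lra.

(** This reflection carries estimates at the left end over to the right end. *)
Lemma sharpen_sym (p q r s : R) : sharpen p q r s = sharpen s r q p.
Proof. minmax. Qed.

Lemma sharpen_ge (p q r s c : R) : c <= q -> c <= r -> c <= sharpen p q r s.
Proof. intros; minmax. Qed.

(* The decrease of the first increment over an outward move followed by an
   inward one. *)
Lemma sharpen_end_le (x y z w : R) :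
  y <= x -> 0 <= y -> 0 <= z -> 0 <= w ->
  sharpen 0 (sharpen 0 0 x y) (sharpen 0 x y z) (sharpen x y z w)
  <= x - 3 / 4 * Rmin y z.
Proof. intros; minmax. Qed.

(** With [p, q, r, s] the four increments, this comes from [q - Rmin p q = Rmax 0 (q - p)] and
    [q - Rmax 0 (q - r) = Rmin q r]. *)
Lemma incr_half_step (u : Z -> R) (j : Z) :
  incr (half_step u) j =
  sharpen (incr u (j - 2)) (incr u (j - 1)) (incr u j) (incr u (j + 1)).
Proof.
unfold half_step, incr.
replace (j + 1 - 1)%Z with j by ring.
replace (j + 1 - 2)%Z with (j - 1)%Z by ring.
replace (j - 2 + 1)%Z with (j - 1)%Z by ring.
replace (j - 1 + 1)%Z with j by ring.
minmax.
Qed.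

(** * Monotone sequences *)

Definition nondecreasing (u : Z -> R) : Prop := forall j, u j <= u (j + 1)%Z.

Lemma nondecreasing_le (u : Z -> R) (i j : Z) :
  nondecreasing u -> (i <= j)%Z -> u i <= u j.
Proof.
intros Hu Hij; revert j Hij; apply Zlt_lower_bound_ind; intros j IH Hij.
destruct (Z.eq_dec i j) as [-> | Hne]; [lra |].
specialize (IH (j - 1)%Z ltac:(lia)); specialize (Hu (j - 1)%Z).
replace (j - 1 + 1)%Z with j in Hu by ring; lra.
Qed.

Lemma incr_ge0 (u : Z -> R) (j : Z) : nondecreasing u -> 0 <= incr u j.
Proof. intros Hu; specialize (Hu j); unfold incr; lra. Qed.

Lemma half_step_between (u : Z -> R) (j : Z) :
  nondecreasing u -> u (j - 1)%Z <= half_step u j <= u j.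
Proof.
intros Hu; pose proof (Hu (j - 2)%Z) as H1; pose proof (Hu (j - 1)%Z) as H2.
specialize (Hu j).
replace (j - 2 + 1)%Z with (j - 1)%Z in H1 by ring.
replace (j - 1 + 1)%Z with j in H2 by ring.
unfold half_step; minmax.
Qed.

Lemma half_step_nondecreasing (u : Z -> R) :
  nondecreasing u -> nondecreasing (half_step u).
Proof.
intros Hu j.
enough (0 <= incr (half_step u) j) by (unfold incr in *; lra).
rewrite incr_half_step; apply sharpen_ge; now apply incr_ge0.
Qed.

(** * Ramps and the motion of their ends *)

Definition ramp (alpha beta c : R) (u : Z -> R) (a b : Z) : Prop :=
  nondecreasing u /\
  (forall j, (j <= a)%Z -> u j = alpha) /\
  (forall j, (b < j)%Z -> u j = beta) /\
  (forall j, (a < j < b)%Z -> c <= incr u j).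

(* The increments of [u] vanish outside [[a, a + 1]]; [c] plays no role. *)
Definition settled (alpha beta c : R) (u : Z -> R) : Prop :=
  exists a, ramp alpha beta c u a (a + 1).

(** Indices are fixed while the frame advances half a cell, so keeping [a] is the outward move and
    [a + 1] the inward one; at the right end [b + 1] is outward and [b] inward. *)
Definition left_end (u : Z -> R) (a : Z) : Z :=
  if Rlt_dec (incr u (a + 1)) (incr u a) then a else (a + 1)%Z.

Definition right_end (u : Z -> R) (b : Z) : Z :=
  if Rlt_dec (incr u (b - 1)) (incr u b) then (b + 1)%Z else b.

Section Ramp.
Variables alpha beta c : R.
Notation ramp := (ramp alpha beta c).
Notation settled := (settled alpha beta c).

Lemma ramp_bounds u a b j : ramp u a b -> alpha <= u j <= beta.
Proof.
intros (Hu & Ha & Hb & _); split.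
- rewrite <- (Ha (Z.min a j)) by lia; apply nondecreasing_le; [trivial | lia].
- rewrite <- (Hb (Z.max (b + 1) j)) by lia.
  apply nondecreasing_le; [trivial | lia].
Qed.

Lemma ramp_incr_le u a b j : ramp u a b -> incr u j <= beta - alpha.
Proof.
intros H; pose proof (ramp_bounds u a b j H).
pose proof (ramp_bounds u a b (j + 1) H); unfold incr; lra.
Qed.

Lemma ramp_incr_left u a b j : ramp u a b -> (j < a)%Z -> incr u j = 0.
Proof.
intros (_ & Ha & _) Hj; unfold incr; rewrite !Ha by lia; ring.
Qed.

Lemma ramp_incr_right u a b j : ramp u a b -> (b < j)%Z -> incr u j = 0.
Proof.
intros (_ & _ & Hb & _) Hj; unfold incr; rewrite !Hb by lia; ring.
Qed.

Lemma ramp_settled u a b : (b <= a + 1)%Z -> ramp u a b -> settled u.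
Proof.
intros Hab (Hu & Ha & Hb & _); exists a; repeat split; trivial.
- intros j Hj; apply Hb; lia.
- intros j Hj; lia.
Qed.

(** The bound [c] survives because a new interior increment depends, up to nonnegative terms, on two
    old ones that are interior or at an end moving outward, and such an end increment exceeds its
    neighbour. *)
Lemma ramp_half_step u a b : (a < b)%Z -> ramp u a b ->
  ramp (half_step u) (left_end u a) (right_end u b).
Proof.
intros Hab H; pose proof H as (Hu & Ha & Hb & Hc).
assert (Hu' := half_step_nondecreasing u Hu).
assert (Ha' : forall j, (j <= a)%Z -> half_step u j = alpha).
{ intros j Hj; pose proof (half_step_between u j Hu) as B.
  rewrite !Ha in B by lia; lra. }
assert (Hb' : forall j, (b + 1 < j)%Z -> half_step u j = beta).
{ intros j Hj; pose proof (half_step_between u j Hu) as B.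
  rewrite !Hb in B by lia; lra. }
assert (G := fun j => incr_ge0 u j Hu).
repeat split; trivial.
- unfold left_end; destruct (Rlt_dec _ _) as [_ | Hl]; trivial.
  intros j Hj; destruct (Z.eq_dec j (a + 1)) as [-> | Hne]; [| apply Ha'; lia].
  (* The minimum vanishes with the increment at [a - 1], and the positive part vanishes because the
     increment at [a] is at most the next one. *)
  assert (E : incr (half_step u) a = 0).
  { rewrite incr_half_step, (ramp_incr_left u a b (a - 2)),
      (ramp_incr_left u a b (a - 1)) by (trivial; lia).
    specialize (G a); minmax. }
  unfold incr in E; rewrite (Ha' a) in E by lia; lra.
- unfold right_end; destruct (Rlt_dec _ _) as [_ | Hl]; trivial.
  intros j Hj; destruct (Z.eq_dec j (b + 1)) as [-> | Hne]; [| apply Hb'; lia].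
  assert (E : incr (half_step u) (b + 1) = 0).
  { rewrite incr_half_step, (ramp_incr_right u a b (b + 1)),
      (ramp_incr_right u a b (b + 1 + 1)) by (trivial; lia).
    replace (b + 1 - 2)%Z with (b - 1)%Z by ring.
    replace (b + 1 - 1)%Z with b by ring.
    specialize (G b); minmax. }
  unfold incr in E; rewrite (Hb' (b + 1 + 1)%Z) in E by lia; lra.
- unfold left_end, right_end; intros j Hj; rewrite incr_half_step.
  destruct (Rlt_dec _ _) as [Hl | Hl]; destruct (Rlt_dec _ _) as [Hr | Hr];
    apply sharpen_ge.
  + destruct (Z.eq_dec j (a + 1)) as [-> | Hne]; [| apply Hc; lia].
    replace (a + 1 - 1)%Z with a by ring.
    enough (c <= incr u (a + 1)) by lra; apply Hc.
    (* On a two-point support, outward moves at both ends would require opposite strict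
       inequalities. *)
    enough (b <> a + 1)%Z by lia; intros ->.
    replace (a + 1 - 1)%Z with a in Hr by ring; lra.
  + destruct (Z.eq_dec j b) as [-> | Hne]; [| apply Hc; lia].
    enough (c <= incr u (b - 1)) by lra; apply Hc.
    enough (b <> a + 1)%Z by lia; intros ->.
    replace (a + 1 - 1)%Z with a in Hr by ring; lra.
  + destruct (Z.eq_dec j (a + 1)) as [-> | Hne]; [| apply Hc; lia].
    replace (a + 1 - 1)%Z with a by ring.
    enough (c <= incr u (a + 1)) by lra; apply Hc; lia.
  + apply Hc; lia.
  + apply Hc; lia.
  + destruct (Z.eq_dec j b) as [-> | Hne]; [| apply Hc; lia].
    enough (c <= incr u (b - 1)) by lra; apply Hc; lia.
  + apply Hc; lia.
  + apply Hc; lia.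
Qed.

Lemma settled_half_step u : settled u -> settled (half_step u).
Proof.
intros [a H]; pose proof (ramp_half_step u a (a + 1) ltac:(lia) H) as H'.
revert H'; apply ramp_settled; unfold left_end, right_end.
replace (a + 1 - 1)%Z with a by ring.
destruct (Rlt_dec _ _); destruct (Rlt_dec _ _); lra || lia.
Qed.

Lemma settled_iter n u : settled u -> settled (Nat.iter n half_step u).
Proof.
intros H; induction n as [| n IH]; simpl; trivial; now apply settled_half_step.
Qed.

(** * Decrease of the potential at each end *)

Lemma half_step_bounds u : nondecreasing u -> (forall j, alpha <= u j <= beta) ->
  forall j, alpha <= half_step u j <= beta.
Proof.
intros Hu B j; pose proof (half_step_between u j Hu).
pose proof (B j); pose proof (B (j - 1)%Z); lra.
Qed.

Lemma incr_half_step_le u j : nondecreasing u -> (forall j, alpha <= u j <= beta) ->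
  incr (half_step u) j <= beta - alpha.
Proof.
intros Hu B; pose proof (half_step_bounds u Hu B j).
pose proof (half_step_bounds u Hu B (j + 1)%Z); unfold incr; lra.
Qed.

(* In the moving frame an outward move costs [8 * (beta - alpha)], which the
   bonus of the first branch pays for; in the second branch,
   [incr (half_step u) (a + 1)] is the first increment after the inward move. *)
Definition left_potential (u : Z -> R) (a : Z) : R :=
  if Rlt_dec (incr u (a + 1)) (incr u a)
  then 8 * (beta - alpha) - c + 4 * incr u a
  else 4 * incr (half_step u) (a + 1).

Definition right_potential (u : Z -> R) (b : Z) : R :=
  if Rlt_dec (incr u (b - 1)) (incr u b)
  then 8 * (beta - alpha) - c + 4 * incr u b
  else 4 * incr (half_step u) b.

Definition potential (u : Z -> R) (a b : Z) : R :=
  16 * (beta - alpha) * IZR (b - a) + left_potential u a + right_potential u b.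

(** The shift [8 * (beta - alpha)] cancels against its opposite at the right end. The bound at
    [a + 2] is a separate premise since for [b = a + 2] that point is the right end. *)
Lemma left_potential_half_step u a b : (a + 2 <= b)%Z -> ramp u a b -> 0 <= c ->
  (incr u (a + 1) < incr u a -> c <= incr u (a + 2)) ->
  left_potential (half_step u) (left_end u a)
    - 16 * (beta - alpha) * IZR (left_end u a - a) + 8 * (beta - alpha)
  <= left_potential u a - c.
Proof.
intros Hab H Hc0 Hz; pose proof H as (Hu & _ & _ & Hc).
assert (Hy : c <= incr u (a + 1)) by (apply Hc; lia).
assert (G := fun j => incr_ge0 u j Hu).
assert (Hu' := half_step_nondecreasing u Hu).
assert (HS : c <= beta - alpha)
  by (pose proof (ramp_incr_le u a b (a + 1) H); lra).
unfold left_potential at 2; unfold left_end.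
destruct (Rlt_dec _ _) as [Hl | Hl].
- specialize (Hz Hl).
  assert (E0 : incr (half_step u) (a - 1) = 0).
  { rewrite incr_half_step, (ramp_incr_left u a b (a - 1 - 2)),
      (ramp_incr_left u a b (a - 1 - 1)), (ramp_incr_left u a b (a - 1))
      by (trivial; lia).
    specialize (G (a - 1 + 1)%Z); minmax. }
  assert (E1 : incr (half_step u) a = sharpen 0 0 (incr u a) (incr u (a + 1))).
  { rewrite incr_half_step, (ramp_incr_left u a b (a - 2)),
      (ramp_incr_left u a b (a - 1)) by (trivial; lia); trivial. }
  assert (E2 : incr (half_step u) (a + 1) =
    sharpen 0 (incr u a) (incr u (a + 1)) (incr u (a + 2))).
  { rewrite incr_half_step.
    replace (a + 1 - 2)%Z with (a - 1)%Z by ring.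
    replace (a + 1 - 1)%Z with a by ring.
    replace (a + 1 + 1)%Z with (a + 2)%Z by ring.
    rewrite (ramp_incr_left u a b (a - 1)) by (trivial; lia); trivial. }
  assert (E3 : incr (half_step u) (a + 2) =
    sharpen (incr u a) (incr u (a + 1)) (incr u (a + 2)) (incr u (a + 3))).
  { rewrite incr_half_step.
    replace (a + 2 - 2)%Z with a by ring.
    replace (a + 2 - 1)%Z with (a + 1)%Z by ring.
    now replace (a + 2 + 1)%Z with (a + 3)%Z by ring. }
  (* Times 4, the drop is [3 * c]: enough for the [c] withheld from the bonus and the [c] to be
     lost. *)
  assert (E : incr (half_step (half_step u)) (a + 1) <= incr u a - 3 / 4 * c).
  { rewrite incr_half_step.
    replace (a + 1 - 2)%Z with (a - 1)%Z by ring.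
    replace (a + 1 - 1)%Z with a by ring.
    replace (a + 1 + 1)%Z with (a + 2)%Z by ring.
    rewrite E0, E1, E2, E3.
    apply Rle_trans with (incr u a - 3 / 4 * Rmin (incr u (a + 1)) (incr u (a + 2))).
    - apply sharpen_end_le; trivial; lra.
    - enough (c <= Rmin (incr u (a + 1)) (incr u (a + 2))) by lra.
      now apply Rmin_glb. }
  rewrite Z.sub_diag; unfold left_potential.
  destruct (Rlt_dec _ _) as [Hl' | _]; [| lra].
  (* With [x > y] the first two increments, the new ones are [(x - y) / 2] and at least [y + x / 2],
     so the next move is inward. *)
  exfalso; revert Hl'; apply Rle_not_lt.
  rewrite E1, E2; specialize (G a); minmax.
(* The inward move leaves a net gain of [8 * (beta - alpha)], which pays the bonus if the next move
   is outward and exceeds the new potential by at least [c] otherwise. *)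
- replace (a + 1 - a)%Z with 1%Z by ring.
  pose proof (incr_ge0 _ (a + 1) Hu').
  pose proof (incr_half_step_le (half_step u) (a + 1 + 1) Hu'
    (half_step_bounds u Hu (fun j => ramp_bounds u a b j H))).
  unfold left_potential; destruct (Rlt_dec _ _); lra.
Qed.

Lemma right_potential_half_step u a b : (a + 2 <= b)%Z -> ramp u a b -> 0 <= c ->
  (incr u (b - 1) < incr u b -> c <= incr u (b - 2)) ->
  right_potential (half_step u) (right_end u b)
    + 16 * (beta - alpha) * IZR (right_end u b - b) - 8 * (beta - alpha)
  <= right_potential u b - c.
Proof.
intros Hab H Hc0 Hz; pose proof H as (Hu & _ & _ & Hc).
assert (Hy : c <= incr u (b - 1)) by (apply Hc; lia).
assert (G := fun j => incr_ge0 u j Hu).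
assert (Hu' := half_step_nondecreasing u Hu).
assert (HS : c <= beta - alpha)
  by (pose proof (ramp_incr_le u a b (b - 1) H); lra).
unfold right_potential at 2; unfold right_end.
destruct (Rlt_dec _ _) as [Hl | Hl].
- specialize (Hz Hl).
  assert (E0 : incr (half_step u) (b + 2) = 0).
  { rewrite incr_half_step, (ramp_incr_right u a b (b + 2 - 1)),
      (ramp_incr_right u a b (b + 2 + 1)), (ramp_incr_right u a b (b + 2))
      by (trivial; lia).
    specialize (G (b + 2 - 2)%Z); minmax. }
  assert (E1 : incr (half_step u) (b + 1) =
    sharpen 0 0 (incr u b) (incr u (b - 1))).
  { rewrite incr_half_step, sharpen_sym, (ramp_incr_right u a b (b + 1 + 1)),
      (ramp_incr_right u a b (b + 1)) by (trivial; lia).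
    replace (b + 1 - 2)%Z with (b - 1)%Z by ring.
    now replace (b + 1 - 1)%Z with b by ring. }
  assert (E2 : incr (half_step u) b =
    sharpen 0 (incr u b) (incr u (b - 1)) (incr u (b - 2))).
  { rewrite incr_half_step, sharpen_sym.
    rewrite (ramp_incr_right u a b (b + 1)) by (trivial; lia); trivial. }
  assert (E3 : incr (half_step u) (b - 1) =
    sharpen (incr u b) (incr u (b - 1)) (incr u (b - 2)) (incr u (b - 3))).
  { rewrite incr_half_step, sharpen_sym.
    replace (b - 1 + 1)%Z with b by ring.
    replace (b - 1 - 1)%Z with (b - 2)%Z by ring.
    now replace (b - 1 - 2)%Z with (b - 3)%Z by ring. }
  assert (E : incr (half_step (half_step u)) (b + 1) <= incr u b - 3 / 4 * c).
  { rewrite incr_half_step, sharpen_sym.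
    replace (b + 1 - 2)%Z with (b - 1)%Z by ring.
    replace (b + 1 - 1)%Z with b by ring.
    replace (b + 1 + 1)%Z with (b + 2)%Z by ring.
    rewrite E0, E1, E2, E3.
    apply Rle_trans with (incr u b - 3 / 4 * Rmin (incr u (b - 1)) (incr u (b - 2))).
    - apply sharpen_end_le; trivial; lra.
    - enough (c <= Rmin (incr u (b - 1)) (incr u (b - 2))) by lra.
      now apply Rmin_glb. }
  replace (b + 1 - b)%Z with 1%Z by ring; unfold right_potential.
  replace (b + 1 - 1)%Z with b by ring.
  destruct (Rlt_dec _ _) as [Hl' | _]; [| lra].
  exfalso; revert Hl'; apply Rle_not_lt.
  rewrite E1, E2; specialize (G b); minmax.
- rewrite Z.sub_diag.
  pose proof (incr_ge0 _ b Hu').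
  pose proof (incr_half_step_le (half_step u) b Hu'
    (half_step_bounds u Hu (fun j => ramp_bounds u a b j H))).
  unfold right_potential; destruct (Rlt_dec _ _); lra.
Qed.

(** * Three-point supports and termination *)

(** If both ends move inward, two points remain after one step. If just one does, the width is kept
    once and then both ends move inward. *)
Lemma ramp3_settled u a : ramp u a (a + 2) ->
  ~ (incr u (a + 1) < incr u a /\ incr u (a + 1) < incr u (a + 2)) ->
  settled (half_step (half_step u)).
Proof.
intros H Hn; pose proof H as (Hu & _).
assert (G := fun j => incr_ge0 u j Hu).
assert (R1 := ramp_half_step u a (a + 2) ltac:(lia) H).
assert (D : forall j, incr (half_step u) (a + j) = sharpen
  (incr u (a + (j - 2))) (incr u (a + (j - 1))) (incr u (a + j)) (incr u (a + (j + 1)))).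
{ intros j; rewrite incr_half_step, Z.add_assoc, <- !Z.add_sub_assoc; trivial. }
assert (L : forall j, (j < 0)%Z -> incr u (a + j) = 0)
  by (intros j Hj; apply (ramp_incr_left u a (a + 2)); [trivial | lia]).
assert (R : forall j, (2 < j)%Z -> incr u (a + j) = 0)
  by (intros j Hj; apply (ramp_incr_right u a (a + 2)); [trivial | lia]).
assert (D0 := D 0%Z); assert (D1 := D 1%Z); assert (D2 := D 2%Z); assert (D3 := D 3%Z).
simpl in D0, D1, D2, D3; rewrite Z.add_0_r in D0, D1, D2.
rewrite (L (-2)%Z), (L (-1)%Z) in D0 by lia.
rewrite (L (-1)%Z) in D1 by lia.
rewrite (R 3%Z) in D2 by lia.
rewrite (R 3%Z), (R 4%Z) in D3 by lia.
assert (G0 := G a); assert (G1 := G (a + 1)%Z); assert (G2 := G (a + 2)%Z).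
unfold left_end, right_end in R1.
replace (a + 2 - 1)%Z with (a + 1)%Z in R1 by ring.
destruct (Rlt_dec _ _) as [Hl | Hl] in R1; destruct (Rlt_dec _ _) as [Hr | Hr] in R1.
- exfalso; apply Hn; split; trivial.
- assert (R2 := ramp_half_step _ a (a + 2) ltac:(lia) R1).
  revert R2; apply ramp_settled; unfold left_end, right_end.
  replace (a + 2 - 1)%Z with (a + 1)%Z by ring.
  destruct (Rlt_dec _ _) as [Hr' | _].
  { exfalso; revert Hr'; apply Rle_not_lt; rewrite D1, D2; clear - Hl Hr G0 G1 G2; minmax. }
  destruct (Rlt_dec _ _) as [Hl' | _]; [| lia].
  exfalso; revert Hl'; apply Rle_not_lt; rewrite D0, D1; clear - Hl Hr G0 G1 G2; minmax.
- replace (a + 2 + 1)%Z with (a + 3)%Z in R1 by ring.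
  assert (R2 := ramp_half_step _ (a + 1) (a + 3) ltac:(lia) R1).
  revert R2; apply ramp_settled; unfold left_end, right_end.
  replace (a + 3 - 1)%Z with (a + 2)%Z by ring.
  replace (a + 1 + 1)%Z with (a + 2)%Z by ring.
  destruct (Rlt_dec _ _) as [Hr' | _].
  { exfalso; revert Hr'; apply Rle_not_lt; rewrite D2, D3; clear - Hl Hr G0 G1 G2; minmax. }
  destruct (Rlt_dec _ _) as [Hl' | _]; [| lia].
  exfalso; revert Hl'; apply Rle_not_lt; rewrite D1, D2; clear - Hl Hr G0 G1 G2; minmax.
- apply settled_half_step; revert R1; apply ramp_settled; lia.
Qed.

(** For [b = a + 2] the end increments have no bound from [ramp]; but if both ends move outward,
    they exceed the middle one and hence [c]. Any other three-point case settles. *)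
Lemma potential_half_step u a b : (a + 2 <= b)%Z -> ramp u a b -> 0 <= c ->
  settled (half_step (half_step u)) \/
  potential (half_step u) (left_end u a) (right_end u b) <= potential u a b - 2 * c.
Proof.
intros Hab H Hc0.
destruct (Z.eq_dec b (a + 2)) as [-> | Hne].
- destruct (excluded_middle_informative
    (incr u (a + 1) < incr u a /\ incr u (a + 1) < incr u (a + 2))) as [[Hl Hr] | Hn];
    [right | left; now apply (ramp3_settled u a)].
  pose proof H as (_ & _ & _ & Hc); specialize (Hc (a + 1)%Z ltac:(lia)).
  assert (PL := left_potential_half_step u a (a + 2) Hab H Hc0 ltac:(lra)).
  assert (PR := right_potential_half_step u a (a + 2) Hab H Hc0).
  replace (a + 2 - 2)%Z with a in PR by ring.
  replace (a + 2 - 1)%Z with (a + 1)%Z in PR by ring.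
  specialize (PR ltac:(lra)).
  unfold potential; rewrite !minus_IZR in *; lra.
- right; pose proof H as (_ & _ & _ & Hc).
  assert (PL := left_potential_half_step u a b Hab H Hc0
    (fun _ => Hc (a + 2)%Z ltac:(lia))).
  assert (PR := right_potential_half_step u a b Hab H Hc0
    (fun _ => Hc (b - 2)%Z ltac:(lia))).
  unfold potential; rewrite !minus_IZR in *; lra.
Qed.

Lemma potential_ge0 u a b : (a + 2 <= b)%Z -> ramp u a b -> 0 <= potential u a b.
Proof.
intros Hab H; pose proof H as (Hu & _ & _ & Hc).
assert (Hu' := half_step_nondecreasing u Hu).
assert (HS : c <= beta - alpha).
{ pose proof (ramp_incr_le u a b (a + 1) H); specialize (Hc (a + 1)%Z ltac:(lia)); lra. }
pose proof (ramp_incr_le u a b a H).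
pose proof (incr_ge0 u a Hu); pose proof (incr_ge0 u b Hu).
pose proof (incr_ge0 _ (a + 1) Hu'); pose proof (incr_ge0 _ b Hu').
assert (0 <= (beta - alpha) * IZR (b - a))
  by (apply Rmult_le_pos; [lra | apply IZR_le; lia]).
unfold potential, left_potential, right_potential.
destruct (Rlt_dec _ _); destruct (Rlt_dec _ _); lra.
Qed.

Lemma ramp_eventually_settled u a b : 0 < c -> ramp u a b ->
  exists n, settled (Nat.iter n half_step u).
Proof.
intros Hc H.
(* Each step costs [2 * c] of a nonnegative potential, so [k] is the fuel of the induction. *)
destruct (INR_archimed (2 * c) (potential u a b) ltac:(lra)) as [k Hk].
revert u a b H Hk; induction k as [| k IH]; intros u a b H Hk.
all: destruct (Z_le_gt_dec b (a + 1)) as [Hw | Hw];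
  [exists 0%nat; now apply (ramp_settled u a b) |].
- pose proof (potential_ge0 u a b ltac:(lia) H); simpl in Hk; lra.
- destruct (potential_half_step u a b ltac:(lia) H ltac:(lra)) as [Hs | Hp];
    [now exists 2%nat |].
  destruct (IH _ _ _ (ramp_half_step u a b ltac:(lia) H)) as [n Hn].
  + rewrite S_INR in Hk; lra.
  + exists (S n); now rewrite Nat.iter_succ_r.
Qed.

End Ramp.

(** * The scheme coincides with [half_step] on monotone data *)

(** The jump [s] may fall outside [[p, q]], hence the clamping. *)
Lemma is_RInt_two_values (f : R -> R) (p q s L R : R) : p <= q ->
  (forall x, p < x < q -> f x = if Rlt_dec x s then L else R) ->
  is_RInt f p q ((Rmax p (Rmin q s) - p) * L + (q - Rmax p (Rmin q s)) * R).
Proof.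
intros Hpq Hf; set (m := Rmax p (Rmin q s)).
assert (Hm : p <= m <= q).
{ split; [apply Rmax_l |]; apply Rmax_lub; [trivial | apply Rmin_l]. }
apply (is_RInt_Chasles (V := R_NormedModule) f p m q).
- apply (is_RInt_ext (fun _ => L));
    [| exact (is_RInt_const (V := R_NormedModule) p m L)].
  rewrite Rmin_left, Rmax_right by lra; intros x Hx.
  rewrite Hf by lra; destruct (Rlt_dec x s) as [_ | Hs]; [trivial |].
  exfalso; unfold m in Hx; revert Hx; minmax; intros; lra.
- apply (is_RInt_ext (fun _ => R));
    [| exact (is_RInt_const (V := R_NormedModule) m q R)].
  rewrite Rmin_left, Rmax_right by lra; intros x Hx.
  rewrite Hf by lra; destruct (Rlt_dec x s) as [Hs | _]; [| trivial].
  exfalso; pose proof (Rmax_r p (Rmin q s) : _ <= m) as Hmin.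
  revert Hmin; minmax; intros; lra.
Qed.

Lemma reconstruction_nondecreasing (dx : R) (u : Z -> R) (j : Z) :
  0 < dx -> nondecreasing u ->
  exists d, 0 <= d <= dx /\
    dx * u j = d * u (j - 1)%Z + (dx - d) * u (j + 1)%Z /\
    forall x, left_edge dx j <= x < right_edge dx j ->
      reconstruction dx u x =
      if Rlt_dec x (left_edge dx j + d) then u (j - 1)%Z else u (j + 1)%Z.
Proof.
intros Hdx Hu.
pose proof (nondecreasing_le u (j - 1) j Hu ltac:(lia)) as H1.
pose proof (nondecreasing_le u j (j + 1) Hu ltac:(lia)) as H2.
destruct (Req_dec (u (j - 1)%Z) (u (j + 1)%Z)) as [He | Hne].
(* By monotonicity all three values agree, so the constant cell is a degenerate jump. *)
- exists 0; split; [lra |]; split; [replace (u j) with (u (j + 1)%Z) by lra; ring |].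
  intros x Hx.
  rewrite (reconstruction_const dx u j); trivial.
  + destruct (Rlt_dec _ _); lra.
  + now intros [d [Hd _]].
- assert (u (j - 1)%Z < u (j + 1)%Z) by lra.
  set (d := dx * ((u (j + 1)%Z - u j) / (u (j + 1)%Z - u (j - 1)%Z))).
  assert (Hd : 0 <= d <= dx).
  { assert (0 <= (u (j + 1)%Z - u j) / (u (j + 1)%Z - u (j - 1)%Z)).
    { apply Rdiv_le_0_compat; lra. }
    assert ((u (j + 1)%Z - u j) / (u (j + 1)%Z - u (j - 1)%Z) <= 1)
      by (apply Rle_div_l; lra).
    unfold d; nra. }
  assert (E : dx * u j = d * u (j - 1)%Z + (dx - d) * u (j + 1)%Z)
    by (unfold d; field; lra).
  exists d; repeat split; trivial; try lra; intros x Hx.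
  now apply reconstruction_jump; [| repeat split |].
Qed.

(** If [d <= h], the right half carries only [R]; otherwise the left half carries only [L] and the
    right half holds the remaining mass [2 * h * C - h * L]. The sign of [h - d] decides which term
    is the minimum. *)
Lemma right_half_mass (h d l L C R : R) : 0 < h -> 0 <= d <= 2 * h -> L <= R ->
  2 * h * C = d * L + (2 * h - d) * R ->
  (Rmax l (Rmin (l + h) (l - h + d)) - l) * L
    + (l + h - Rmax l (Rmin (l + h) (l - h + d))) * R
  = h * Rmin R (2 * C - L).
Proof.
intros Hh Hd HLR E.
assert (E' : h * (2 * C - L - R) = (h - d) * (R - L)) by lra.
destruct (Rle_dec d h) as [Hdh | Hdh].
- rewrite (Rmin_right (l + h)), Rmax_left, Rmin_left by (lra || nra); ring.
- rewrite (Rmin_right (l + h)), Rmax_right, Rmin_right by (lra || nra); lra.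
Qed.

Lemma left_half_mass (h d l L C R : R) : 0 < h -> 0 <= d <= 2 * h -> L <= R ->
  2 * h * C = d * L + (2 * h - d) * R ->
  (Rmax l (Rmin (l + h) (l + d)) - l) * L
    + (l + h - Rmax l (Rmin (l + h) (l + d))) * R
  = h * Rmax L (2 * C - R).
Proof.
intros Hh Hd HLR E.
assert (E' : h * (2 * C - L - R) = (h - d) * (R - L)) by lra.
destruct (Rle_dec d h) as [Hdh | Hdh].
- rewrite (Rmin_right (l + h)), Rmax_right, Rmax_right by (lra || nra); lra.
- rewrite (Rmin_left (l + h)), Rmax_right, Rmax_left by (lra || nra); ring.
Qed.

(* The left half of cell [j] is filled from the right half of cell [j - 1], and
   its right half from the left half of cell [j]. *)
Lemma DL_step_half (V dt dx : R) (u : Z -> R) (j : Z) : 0 < dx ->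
  V * dt = dx / 2 -> nondecreasing u -> DL_step V dt dx u j = half_step u j.
Proof.
intros Hdx Hh Hu; unfold DL_step; rewrite Hh.
pose proof (nondecreasing_le u (j - 2) j Hu ltac:(lia)) as H1.
pose proof (nondecreasing_le u (j - 1) (j + 1) Hu ltac:(lia)) as H2.
destruct (reconstruction_nondecreasing dx u (j - 1) Hdx Hu) as (d & Hd & E & F).
destruct (reconstruction_nondecreasing dx u j Hdx Hu) as (d' & Hd' & E' & F').
replace (j - 1 - 1)%Z with (j - 2)%Z in E, F by ring.
replace (j - 1 + 1)%Z with j in E, F by ring.
set (h := dx / 2) in *; set (l := left_edge dx j) in *.
assert (E1 : left_edge dx (j - 1) = l - 2 * h)
  by (unfold l, h, left_edge, node; rewrite minus_IZR; field).
assert (E2 : right_edge dx (j - 1) = l)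
  by (unfold l, left_edge, right_edge, node; rewrite minus_IZR; field).
assert (E3 : right_edge dx j = l + h + h)
  by (unfold l, h, left_edge, right_edge; field).
assert (E4 : dx = 2 * h) by (unfold h; field).
rewrite E1, E2 in F; rewrite E3 in F' |- *.
rewrite E4 in Hd, Hd', E, E'.
assert (I1 := is_RInt_two_values (fun x => reconstruction dx u (x - h))
  l (l + h) (l - h + d) (u (j - 2)%Z) (u j) ltac:(lra)).
assert (I2 := is_RInt_two_values (fun x => reconstruction dx u (x - h))
  (l + h) (l + h + h) (l + h + d') (u (j - 1)%Z) (u (j + 1)%Z) ltac:(lra)).
rewrite (right_half_mass h d l _ (u (j - 1)%Z)) in I1 by lra.
rewrite (left_half_mass h d' (l + h) _ (u j)) in I2 by lra.
rewrite (is_RInt_unique _ _ _ _ (is_RInt_Chasles (V := R_NormedModule) _ _ _ _ _ _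
  (I1 ltac:(intros x Hx; rewrite F by lra;
            do 2 destruct (Rlt_dec _ _); trivial; lra))
  (I2 ltac:(intros x Hx; rewrite F' by lra;
            do 2 destruct (Rlt_dec _ _); trivial; lra)))).
unfold half_step, plus; simpl; rewrite E4; field; lra.
Qed.

(** Monotonicity is carried through the induction because [DL_step_half] requires it at every
    step. *)
Lemma DL_scheme_half (V dt dx : R) (u : Z -> R) (n : nat) : 0 < dx ->
  V * dt = dx / 2 -> nondecreasing u ->
  DL_scheme V dt dx u n = Nat.iter n half_step u /\
  nondecreasing (Nat.iter n half_step u).
Proof.
intros Hdx Hh Hu; induction n as [| n [IH Hn]]; simpl; [now split |].
split; [| now apply half_step_nondecreasing].
rewrite IH; apply functional_extensionality; intros j.
now apply DL_step_half.
Qed.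

(** * From the initial data to the final profile *)

Lemma positive_lower_bound (f : Z -> R) (a b : Z) :
  (forall j, (a < j < b)%Z -> 0 < f j) ->
  exists c, 0 < c /\ forall j, (a < j < b)%Z -> c <= f j.
Proof.
intros Hf; destruct (Z_lt_le_dec b a) as [Hba | Hab].
{ exists 1; split; [lra | intros; lia]. }
revert b Hab Hf; apply (Zlt_lower_bound_ind (fun b => _ -> _)).
intros b IH Hab Hf.
destruct (Z_le_gt_dec b (a + 1)) as [Hb | Hb].
{ exists 1; split; [lra | intros; lia]. }
destruct (IH (b - 1)%Z ltac:(lia)) as (c & Hc & Hcf);
  [intros; apply Hf; lia |].
exists (Rmin c (f (b - 1)%Z)); split.
- apply Rmin_glb_lt; [| apply Hf]; trivial; lia.
- intros j Hj; destruct (Z.eq_dec j (b - 1)) as [-> | Hne]; [apply Rmin_r |].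
  apply Rle_trans with c; [apply Rmin_l | apply Hcf; lia].
Qed.

Theorem theorem2 (V dt dx : R) (HV : 0 < V) (Hdt : 0 < dt) (Hdx : 0 < dx)
  (Hlambda : V * dt / dx = 1 / 2)
  (alpha beta : R) (Hab : alpha < beta)
  (u0 : Z -> R)
  (Hu0 : exists j0 M : Z,
     (1 <= M)%Z /\
     (forall j : Z, (j <= j0)%Z -> u0 j = alpha) /\
     (forall j : Z, (j0 + M <= j)%Z -> u0 j = beta) /\
     (forall j : Z, (j0 <= j <= j0 + M - 1)%Z -> u0 j < u0 (j + 1)%Z)) :
  exists N : nat, forall n : nat, (N <= n)%nat ->
    exists jinf : Z,
      (forall j : Z, (j < jinf)%Z -> DL_scheme V dt dx u0 n j = alpha) /\
      (forall j : Z, (j > jinf)%Z -> DL_scheme V dt dx u0 n j = beta).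
Proof.
destruct Hu0 as (j0 & M & HM & Ha & Hb & Hi).
assert (Hh : V * dt = dx / 2).
{ replace (V * dt) with (V * dt / dx * dx) by (field; lra); rewrite Hlambda; field. }
assert (Hu : nondecreasing u0).
{ intros j; destruct (Z_lt_le_dec j j0) as [Hj | Hj]; [rewrite !Ha by lia; lra |].
  destruct (Z_lt_le_dec j (j0 + M)) as [Hj' | Hj'];
    [apply Rlt_le, Hi; lia | rewrite !Hb by lia; lra]. }
(* The last positive increment sits at [j0 + M - 1], between the cells [j0 + M - 1] and [j0 + M]. *)
destruct (positive_lower_bound (incr u0) j0 (j0 + M - 1)) as (c & Hc & Hcu).
{ intros j Hj; unfold incr; specialize (Hi j ltac:(lia)); lra. }
destruct (ramp_eventually_settled alpha beta c u0 j0 (j0 + M - 1) Hc)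
  as [N HN].
{ repeat split; trivial; intros j Hj; apply Hb; lia. }
exists N; intros n Hn.
destruct (DL_scheme_half V dt dx u0 n Hdx Hh Hu) as [-> _].
replace n with (n - N + N)%nat by lia; rewrite Nat.iter_add.
destruct (settled_iter alpha beta c (n - N) _ HN) as (a & _ & Sa & Sb & _).
(* Increments at [a] and [a + 1] only leave a single intermediate value, at [a + 1]. *)
exists (a + 1)%Z; split; intros j Hj; [apply Sa | apply Sb]; lia.
Qed.
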